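(* Let $X=\mathbb{C}^n$ and consider $u'(t)=F(u(t))=Lu(t)+N(u(t))$, $u(t_0)=u_0$, satisfying Assumptions 1 and 3 below. Assume that $\operatorname{Re}(u,Lu)\le0$ for all $u\in X$ and that $L\frac{d}{dt}N(u(t))\big|_{t=t_n}$ is uniformly bounded on $X$. Let $u_n$ be the numerical solution produced with constant step $h$ by either of the hybrid implicit-explicit exponential methods $$\text{(HImExp2J)}\quad U_{n2}=u_n+\tfrac12h(I-\tfrac12hL)^{-1}F(u_n),\quad u_{n+1}=u_n+h(I-\tfrac12hL)^{-1}F(u_n)+2h\varphi_2(hJ_n)\big(N(U_{n2})-N(u_n)\big),$$ $$\text{(HImExp2N)}\quad U_{n2}=u_n+\tfrac12h(I-\tfrac12hL)^{-1}F(u_n),\quad u_{n+1}=u_n+h(I-\tfrac12hL)^{-1}F(u_n)+2h\varphi_2(hN'_n)\big(N(U_{n2})-N(u_n)\big),$$ where $N'_n=N'(u_n)$ and $J_n=L+N'_n$. Then $\|u_n-u(t_n)\|\le Ch^2$ uniformly on $t_0\le t_n=t_0+nh\le T$, with a constant $C$ that depends on $T-t_0$ but is independent of $n$ and $h$.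
   Context: $\varphi_2(z)=\int_0^1 e^{(1-\theta)z}\theta\,d\theta$. $(\cdot,\cdot)$ is the standard inner product on $\mathbb{C}^n$. Assumption 1: $L$ is the generator of a strongly continuous semigroup $e^{tL}$ on $X$. Assumption 3: the problem possesses a solution that is three times differentiable with uniformly bounded derivatives in $X$, and $N:X\to X$ is twice continuously Fréchet differentiable in a strip along the exact solution.
   Formalization: The bound is proved for step sizes 0 < h ≤ h0 with some h0 > 0 (C and h0 may depend on the problem, including L); without such a restriction it fails, since N is unconstrained outside the strip. *)

(* Defs.v *)
(* X = C^n is modelled as row vectors
   'rV[Cx R]_n over the complex numbers R[i] of an arbitrary realType R.
   Convention: a linear operator A on X (a matrix) acts on the RIGHT,
   A(v) := v *m A, consistently with MathComp-Analysis' [jacobian]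
   ('d f x v = v *m jacobian f x). *)
From mathcomp Require Import all_boot all_algebra.
From mathcomp Require Import all_classical all_reals all_analysis.
From mathcomp Require Import complex.
Import GRing.Theory Num.Theory numFieldNormedType.Exports.
Local Open Scope ring_scope.
Local Open Scope classical_set_scope.
Local Open Scope complex_scope.

Set Implicit Arguments.
Unset Strict Implicit.
Unset Printing Implicit Defensive.

(* The complex numbers over R, viewed as a numFieldType (so that the
   MathComp-Analysis topology / normed structures are found by inference). *)
Definition Cx (R : realType) : numFieldType := R[i].

Definition cip (R : realType) (n : nat) (u v : 'rV[Cx R]_n) : Cx R :=
  \sum_(j < n) (u 0 j)^* * v 0 j.

Definition cnorm (R : realType) (n : nat) (u : 'rV[Cx R]_n) : R :=
  Num.sqrt (complex.Re (cip u u)).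

Definition has_rderiv_on (R : realType) (n : nat) (a b : R)
    (f df : R -> 'rV[Cx R]_n) : Prop :=
  forall t, a <= t <= b ->
    (fun s : R => (s^-1)%:C *: (f (t + s) - f t))
      @ within [set s | a <= t + s <= b] (0 : R)^' --> df t.

Definition strip (R : realType) (n : nat) (t0 T : R) (u : R -> 'rV[Cx R]_n)
    (delta : R) : set 'rV[Cx R]_n :=
  [set v | exists2 t, t0 <= t <= T & cnorm (v - u t) < delta].

(* N : X -> X is twice continuously (complex) Frechet differentiable at every
   point of S: N is differentiable, its derivative N' (the Jacobian matrix,
   vectorised) is differentiable, and the second derivative is continuous. *)
Definition C2_on (R : realType) (n : nat) (N : 'rV[Cx R]_n -> 'rV[Cx R]_n)
    (S : set 'rV[Cx R]_n) : Prop :=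
  forall v, S v ->
    [/\ differentiable N v,
        differentiable (fun w => mxvec (jacobian N w)) v &
        {for v, continuous (fun w => jacobian (fun x => mxvec (jacobian N x)) w)}].

(* phi_2(Z) = int_0^1 e^{(1-theta) Z} theta dtheta = sum_{k>=0} Z^k/(k+2)!,
   defined for matrices through its (everywhere convergent) power series. *)
Definition phi2 (R : realType) (n : nat) (Z : 'M[Cx R]_n) : 'M[Cx R]_n :=
  limn (series (fun k : nat => ((k.+2)`!%:R : Cx R)^-1 *: Z ^+ k)).

Definition himexp2_step (R : realType) (n : nat)
    (Phi : 'rV[Cx R]_n -> 'M[Cx R]_n) (L : 'M[Cx R]_n)
    (N : 'rV[Cx R]_n -> 'rV[Cx R]_n) (h : R) (v : 'rV[Cx R]_n) : 'rV[Cx R]_n :=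
  let F := v *m L + N v in
  let G := F *m invmx (1%:M - (h / 2)%:C *: L) in
  let U2 := v + (h / 2)%:C *: G in
  v + h%:C *: G + (2 * h)%:C *: ((N U2 - N v) *m phi2 (h%:C *: Phi v)).

Definition himexp2_sol (R : realType) (n : nat)
    (Phi : 'rV[Cx R]_n -> 'M[Cx R]_n) (L : 'M[Cx R]_n)
    (N : 'rV[Cx R]_n -> 'rV[Cx R]_n) (h : R) (u0 : 'rV[Cx R]_n) (k : nat) :=
  iter k (himexp2_step Phi L N h) u0.

Definition HImExp2J_sol (R : realType) (n : nat) (L : 'M[Cx R]_n)
    (N : 'rV[Cx R]_n -> 'rV[Cx R]_n) (h : R) (u0 : 'rV[Cx R]_n) (k : nat) :=
  himexp2_sol (fun v => L + jacobian N v) L N h u0 k.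

Definition HImExp2N_sol (R : realType) (n : nat) (L : 'M[Cx R]_n)
    (N : 'rV[Cx R]_n -> 'rV[Cx R]_n) (h : R) (u0 : 'rV[Cx R]_n) (k : nat) :=
  himexp2_sol (fun v => jacobian N v) L N h u0 k.

(* Main.v *)
(** Consistency and stability both reduce to the explicit midpoint rule.  Write
    f(v) = L v + N(v) and let G = (I - hL/2)^{-1} f(v), so that
    G = f(v) + (h/2) L G.  Since N(U_{n2}) - N(u_n) = O(h) and
    phi_2(hZ) = I/2 + O(h) for bounded Z, one step of either method equals
    v + h f(v + (h/2) f(v)) + O(h^3), uniformly for v in a tube around the exact
    solution.  As f is Lipschitz on the tube (compactness of [t0, T]) and u has
    a bounded third derivative, the midpoint rule satisfies
    e_{k+1} <= (1 + Ch) e_k + C h^3, whence e_k <= h^2 ((1 + Ch)^k - 1), which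
    also keeps the iterates in the tube for small h.  Here C may depend on the
    norm of the matrix L.

    All estimates use the real-valued l1 norm of real and imaginary parts: the
    library norm on complex matrices takes values in the partially ordered
    field C, which is awkward in inequalities. *)
Require Import Defs.
From mathcomp Require Import all_boot all_order all_algebra.
From mathcomp Require Import all_classical all_reals all_analysis.
From mathcomp Require Import complex.
From mathcomp Require Import ring lra.
Import Order.TTheory GRing.Theory Num.Theory numFieldNormedType.Exports.
Local Open Scope ring_scope.
Local Open Scope classical_set_scope.
Local Open Scope complex_scope.

Set Implicit Arguments.
Unset Strict Implicit.
Unset Printing Implicit Defensive.

(** * The l1 norm *)

Section L1Norm.
Variable R : realType.
Implicit Types z w : Cx R.

Definition l1C z : R := `|complex.Re z| + `|complex.Im z|.

Lemma l1C_ge0 z : 0 <= l1C z.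
Proof. by rewrite addr_ge0. Qed.

Lemma l1CD z w : l1C (z + w) <= l1C z + l1C w.
Proof.
case: z w => [a b] [c d]; rewrite /l1C /= addrACA.
by rewrite lerD // ler_normD.
Qed.

Lemma l1CM z w : l1C (z * w) <= l1C z * l1C w.
Proof.
case: z w => [a b] [c d]; rewrite /l1C /=.
apply: (@le_trans _ _ ((`|a| * `|c| + `|b| * `|d|) + (`|a| * `|d| + `|b| * `|c|))).
  by rewrite lerD // -!normrM ?ler_normB ?ler_normD.
by rewrite le_eqVlt; apply/orP; left; apply/eqP; ring.
Qed.

Lemma l1CZ (a : R) z : l1C (a%:C * z) = `|a| * l1C z.
Proof.
case: z => [c d]; rewrite /l1C /=.
by rewrite !mul0r subr0 addr0 !normrM mulrDr.
Qed.

Lemma l1C_eq0 z : l1C z = 0 -> z = 0.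
Proof.
case: z => [a b]; rewrite /l1C /= => /eqP.
rewrite paddr_eq0 // !normr_eq0 => /andP[/eqP -> /eqP ->] //.
Qed.

Lemma normC_le_l1 z : `|z| <= (l1C z)%:C.
Proof.
case: z => [a b]; rewrite normc_def lecR /l1C /=.
have h : 0 <= `|a| + `|b| by rewrite addr_ge0.
rewrite -[leRHS](ger0_norm h) -[leRHS]sqrtr_sqr ler_wsqrtr //.
rewrite -[a ^+ 2]real_normK ?num_real // -[b ^+ 2]real_normK ?num_real //.
have := normr_ge0 a; have := normr_ge0 b; nra.
Qed.

Lemma l1_le_normC z (e : R) : `|z| <= e%:C -> l1C z <= 2 * e.
Proof.
case: z => [a b]; rewrite normc_def lecR /l1C /= => h.
have ha : `|a| <= e.
  apply: le_trans h; rewrite -sqrtr_sqr ler_wsqrtr // lerDl sqr_ge0 //.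
have hb : `|b| <= e.
  apply: le_trans h; rewrite -sqrtr_sqr ler_wsqrtr // lerDr sqr_ge0 //.
lra.
Qed.

(** Summing over all entries makes this norm submultiplicative for every shape, with no dimension
    factor. *)
Definition l1M m n (A : 'M[Cx R]_(m, n)) : R := \sum_i \sum_j l1C (A i j).

Section Matrices.
Variables m n : nat.
Implicit Types A B C : 'M[Cx R]_(m, n).

Lemma l1M_ge0 A : 0 <= l1M A.
Proof. by apply: sumr_ge0 => i _; apply: sumr_ge0 => j _; apply: l1C_ge0. Qed.

Lemma l1MD A B : l1M (A + B) <= l1M A + l1M B.
Proof.
rewrite /l1M -big_split ler_sum //= => i _.
by rewrite -big_split ler_sum //= => j _; rewrite !mxE l1CD.
Qed.

Lemma l1MZ (a : R) A : l1M (a%:C *: A) = `|a| * l1M A.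
Proof.
rewrite /l1M mulr_sumr; apply: eq_bigr => i _.
by rewrite mulr_sumr; apply: eq_bigr => j _; rewrite !mxE l1CZ.
Qed.

Lemma l1M0 : l1M (0 : 'M[Cx R]_(m, n)) = 0.
Proof.
rewrite /l1M big1 // => i _; rewrite big1 // => j _.
by rewrite mxE /l1C /= normr0 addr0.
 Qed.

Lemma l1MN A : l1M (- A) = l1M A.
Proof.
rewrite -scaleN1r (_ : -1 = (-1)%:C :> Cx R); last by rewrite rmorphN.
by rewrite l1MZ normrN normr1 mul1r.
Qed.

Lemma l1MB A B : l1M (A - B) <= l1M A + l1M B.
Proof. by rewrite -(l1MN B) l1MD. Qed.

Lemma l1M_distC A B : l1M (A - B) = l1M (B - A).
Proof. by rewrite -l1MN opprB. Qed.

Lemma l1M_distD A B C : l1M (A - C) <= l1M (A - B) + l1M (B - C).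
Proof. by rewrite -[A - C](subrKA B) l1MD. Qed.

Lemma l1M_distDr A B : l1M A <= l1M B + l1M (A - B).
Proof. by rewrite -[A in l1M A](subrK B) addrC l1MD. Qed.

Lemma l1M_entry A i j : l1C (A i j) <= l1M A.
Proof.
rewrite /l1M (bigD1 i) //= (bigD1 j) //= -addrA lerDl addr_ge0 //.
  by apply: sumr_ge0 => k _; apply: l1C_ge0.
by apply: sumr_ge0 => k _; apply: sumr_ge0 => k' _; apply: l1C_ge0.
Qed.

Lemma l1M_eq0 A : l1M A = 0 -> A = 0.
Proof.
move=> h; apply/matrixP => i j; rewrite mxE; apply: l1C_eq0; apply/eqP.
by rewrite eq_le l1C_ge0 -h l1M_entry.
Qed.

End Matrices.

Lemma l1MM m n p (A : 'M[Cx R]_(m, n)) (B : 'M[Cx R]_(n, p)) :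
  l1M (A *m B) <= l1M A * l1M B.
Proof.
rewrite {1 2}/l1M mulr_suml ler_sum // => i _.
rewrite mulr_suml.
apply: (@le_trans _ _ (\sum_j \sum_k l1C (A i k) * l1C (B k j))).
  apply: ler_sum => j _; rewrite mxE.
  elim/big_ind2 : _ => [|x y z w h1 h2|k _]; last exact: l1CM.
    by rewrite /l1C /= normr0 addr0.
  by rewrite (le_trans (l1CD _ _)) ?lerD.
rewrite exchange_big ler_sum //= => k _; rewrite -mulr_sumr.
rewrite ler_wpM2l ?l1C_ge0 //.
rewrite /l1M (bigD1 k) //= lerDl.
by apply: sumr_ge0 => k' _; apply: sumr_ge0 => ? _; apply: l1C_ge0.
Qed.

Lemma cnorm2E n (v : 'rV[Cx R]_n) :
  complex.Re (cip v v) =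
  \sum_j ((complex.Re (v 0 j)) ^+ 2 + (complex.Im (v 0 j)) ^+ 2).
Proof.
rewrite /cip.
elim/big_rec2 : _ => //= j x y _ <-.
by case: (v 0 j) => a b; case: y => c d /=; ring.
Qed.

Lemma cnorm_le_l1 n (v : 'rV[Cx R]_n) : cnorm v <= l1M v.
Proof.
rewrite /cnorm cnorm2E -(ger0_norm (l1M_ge0 v)) -sqrtr_sqr ler_wsqrtr //.
rewrite /l1M big_ord1.
(* The sign of the partial sum is carried through the induction, since the cross term of its square
   has to be discarded. *)
suff: 0 <= \sum_j l1C (v 0 j) /\
  \sum_(j < n) (complex.Re (v 0 j) ^+ 2 + complex.Im (v 0 j) ^+ 2)
  <= (\sum_j l1C (v 0 j)) ^+ 2 by case.
elim/big_rec2 : _ => [|j x y _ [hx h]]; first by rewrite expr0n.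
have hj := l1C_ge0 (v 0 j).
split; first by rewrite addr_ge0.
apply: (@le_trans _ _ (l1C (v 0 j) ^+ 2 + y ^+ 2)); last by nra.
rewrite lerD // /l1C -[_ ^+ 2 as X in X + _]real_normK ?num_real //.
rewrite -[complex.Im _ ^+ 2]real_normK ?num_real //.
have := normr_ge0 (complex.Re (v 0 j)); have := normr_ge0 (complex.Im (v 0 j)); nra.
Qed.

Lemma l1_le_cnorm n (v : 'rV[Cx R]_n) : l1M v <= n%:R * 2 * cnorm v.
Proof.
rewrite /l1M big_ord1.
apply: (@le_trans _ _ (\sum_(j < n) 2 * cnorm v)); last first.
  rewrite big_const_ord iter_addr_0 -[leLHS]mulr_natl mulrA.
  by [].
apply: ler_sum => j _; apply: l1_le_normC.
rewrite normc_def lecR /cnorm cnorm2E ler_wsqrtr //.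
by rewrite [leRHS](bigD1 j) //= lerDl sumr_ge0 // => k _; rewrite addr_ge0 // sqr_ge0.
Qed.

End L1Norm.

(** * Neighbourhoods and derivatives expressed in the l1 norm *)

Section Topology.
Variable R : realType.

Section Balls.
Variables m n : nat.
Implicit Types A B : 'M[Cx R]_(m, n).

Lemma normM_le_l1 A : `|A| <= (l1M A)%:C.
Proof.
rewrite -[`|A|]/(mx_norm A); have [->|] := eqVneq (mx_norm A) 0.
  by rewrite ler0c l1M_ge0.
move=> /mx_norm_neq0 [[i j] ->] /=.
by apply: le_trans (normC_le_l1 _) _; rewrite lecR l1M_entry.
Qed.

Lemma norm_entry_le A i j : `|A i j| <= `|A|.
Proof.
rewrite -[`|A|]/(mx_norm A) mx_normE.
set M := \big[_/_]_k _.
by have /bigmax_leP [_ /(_ (i, j) isT)] : M <= M by []; rewrite -num_le.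
Qed.

Lemma l1_le_normM A (e : R) : `|A| <= e%:C -> l1M A <= m%:R * n%:R * 2 * e.
Proof.
move=> h; have H i j : l1C (A i j) <= 2 * e.
  by apply: l1_le_normC; apply: le_trans h; apply: norm_entry_le.
apply: (@le_trans _ _ (\sum_(i < m) \sum_(j < n) 2 * e)).
  by apply: ler_sum => i _; apply: ler_sum => j _.
rewrite !big_const_ord !iter_addr_0 -[leLHS]mulr_natl -[_ *+ n]mulr_natl.
by rewrite !mulrA.
Qed.

(** Equivalence of norms; it turns every later filter statement into one with a real radius. *)
Lemma nbhs_l1P A (P : set 'M[Cx R]_(m, n)) :
  nbhs A P <-> exists2 r : R, 0 < r & forall B, l1M (B - A) < r -> P B.
Proof.
split=> [/nbhs_normP [e /= e0 he]|[r r0 hr]].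
  (* A positive complex radius has zero imaginary part, so it can be read as a real number. *)
  case: e e0 he => [e b]; rewrite ltcE /= => /andP[/eqP b0 e0] he; subst b.
  exists e => // B hB; apply: he => /=.
  rewrite distrC; apply: le_lt_trans (normM_le_l1 _) _.
  by rewrite -[e +i* 0]/(e%:C) ltcR.
(* The added 1 keeps [c] positive for empty matrices and makes the final comparison strict. *)
change (\near A, P A); apply/nbhs_normP; pose c : R := m%:R * n%:R * 2 + 1.
have c0 : 0 < c by rewrite ltr_wpDl // !mulr_ge0.
exists (r / c)%:C; first by rewrite /= ltcR divr_gt0.
move=> B /=; rewrite distrC => /ltW /l1_le_normM h; apply: hr.
apply: le_lt_trans h _.
rewrite mulrA mulrAC -[ltRHS]mul1r ltr_pM2r // ltr_pdivrMr // mul1r.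
by rewrite ltrDl.
Qed.

End Balls.

Lemma differentiable_l1 n m (f : 'rV[Cx R]_n -> 'rV[Cx R]_m) v :
  differentiable f v -> forall e : R, 0 < e ->
  exists2 d : R, 0 < d & forall w, l1M (w - v) < d ->
    l1M (f w - f v - (w - v) *m jacobian f v) <= e * l1M (w - v).
Proof.
move=> df e e0.
have /eqaddoP := diff_locally df.
pose c : R := m%:R * 2 + 1.
have c0 : 0 < c by rewrite ltr_wpDl // !mulr_ge0.
move=> /(_ (e / c)%:C); rewrite ltcR divr_gt0 // => /(_ isT).
move=> /nbhs_l1P [d d0 hd]; exists d => // w hw.
have /= := hd (w - v); rewrite subr0 => /(_ hw).
rewrite !fctE /= subrK /cst opprD addrA /jacobian mul_rV_lin1 => h.
have : `|f w - f v - 'd f v (w - v)| <= (e / c * l1M (w - v))%:C.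
  apply: le_trans h _; rewrite [leRHS]rmorphM ler_wpM2l ?normM_le_l1 //.
  by rewrite ler0c ltW // divr_gt0.
move=> /l1_le_normM /le_trans; apply.
rewrite mulrA ler_wpM2r ?l1M_ge0 // mul1r mulrA mulrAC.
rewrite ler_piMl ?(ltW e0) // ler_pdivrMr // mul1r.
by rewrite lerDl.
Qed.

Lemma l1M_mxvec m n (A : 'M[Cx R]_(m, n)) : l1M A <= m%:R * n%:R * l1M (mxvec A).
Proof.
apply: (@le_trans _ _ (\sum_(i < m) \sum_(j < n) l1M (mxvec A))).
  apply: ler_sum => i _; apply: ler_sum => j _.
  by rewrite -mxvecE l1M_entry.
rewrite !big_const_ord !iter_addr_0 -[leLHS]mulr_natl -[_ *+ n]mulr_natl.
by rewrite !mulrA.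
Qed.

Lemma has_rderiv_onE n (a b : R) (f df : R -> 'rV[Cx R]_n) :
  has_rderiv_on a b f df -> forall t, a <= t <= b -> forall e : R, 0 < e ->
  exists2 d : R, 0 < d & forall s, a <= s <= b -> `|s - t| < d ->
    l1M (f s - f t - (s - t)%:C *: df t) <= e * `|s - t|.
Proof.
move=> H t ht e e0.
have : nbhs (df t) [set w | l1M (w - df t) < e] by apply/nbhs_l1P; exists e.
move=> /(H t ht).
rewrite /= /fmap /within /= /dnbhs /within /= => /nbhs_ballP [d /= d0 hd].
exists d => // s hs hst.
(* The punctured filter says nothing at [s = t], where the increment form is trivial. *)
have [->|st] := eqVneq s t.
  by rewrite !subrr scale0r subr0 l1M0 normr0 mulr0.
have st' : s - t != 0 by rewrite subr_eq0.
have /= := hd (s - t); rewrite /ball /= sub0r normrN => /(_ hst st').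
rewrite [t + _]addrC subrK => /(_ hs) /ltW h.
have E : (s - t)%:C *: ((s - t)^-1%:C *: (f s - f t)) = f s - f t.
  by rewrite scalerA -rmorphM divff // rmorph1 scale1r.
by rewrite -E -scalerBr l1MZ mulrC ler_wpM2r.
Qed.

End Topology.

(** * Mean value and Taylor estimates *)

Section MeanValue.
Variables (R : realType) (n : nat).
Implicit Types f : R -> 'rV[Cx R]_n.

(** The points satisfying the bound with slope [M + e] have a supremum, which satisfies it too and
    cannot lie before [b]; then [e] tends to 0. *)
Lemma mean_value_l1 f (a b M : R) : a <= b ->
  (forall t, a <= t <= b -> forall e : R, 0 < e ->
     exists2 d : R, 0 < d & forall s, a <= s <= b -> `|s - t| < d ->
       l1M (f s - f t) <= (M + e) * `|s - t|) ->
  l1M (f b - f a) <= M * (b - a).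
Proof.
move=> ab H.
suff He (e : R) : 0 < e -> l1M (f b - f a) <= (M + e) * (b - a).
  apply/ler_addgt0Pr => e e0.
  have c0 : 0 < b - a + 1 by rewrite ltr_wpDl // subr_ge0.
  apply: le_trans (He (e / (b - a + 1)) _) _; first by rewrite divr_gt0.
  rewrite mulrDl lerD2l -mulrA ler_piMr ?(ltW e0) //.
  by rewrite ler_pdivrMl // mulr1 lerDl.
move=> e0.
pose S := [set x | a <= x <= b /\ l1M (f x - f a) <= (M + e) * (x - a)].
have Sa : S a by rewrite /S /= lexx ab !subrr l1M0 mulr0.
have Sub : ubound S b by move=> x [/andP[]].
have hS : has_sup S by split; [exists a | exists b].
have ac : a <= sup S by apply: ub_le_sup => //; exists b.
have cb : sup S <= b by apply: ge_sup => //; exists a.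
set c := sup S in ac cb *.
have [|d d0 hd] := H c _ e e0; first by rewrite ac cb.
have Sc : S c.
  split; first by rewrite ac cb.
  have [x [/andP[ax xb] hx] cx] := sup_adherent d0 hS.
  have xc : x <= c by apply: ub_le_sup; [exists b | rewrite /S /= ax xb].
  have dx : `|x - c| < d.
    by rewrite distrC ger0_norm ?subr_ge0 //; move: cx; rewrite -/c; lra.
  have := hd x _ dx; rewrite ax xb => /(_ isT).
  rewrite distrC ger0_norm ?subr_ge0 // l1M_distC => h.
  rewrite (_ : f c - f a = (f c - f x) + (f x - f a)); last by rewrite addrA subrK.
  by apply: le_trans (l1MD _ _) _; lra.
have [<-|cb'] := eqVneq c b; first by case: Sc.
have {}cb' : c < b by rewrite lt_neqAle cb'.
(* A move of at most [d / 2] stays within reach of the local estimate at [c], so a supremum below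
   [b] would be exceeded. *)
pose s := Num.min b (c + d / 2).
have cs : c < s by rewrite lt_min cb' ltrDl divr_gt0.
have sb : s <= b by rewrite ge_min lexx.
have sd : s <= c + d / 2 by rewrite ge_min lexx orbT.
have Ss : S s.
  split; first by rewrite sb (le_trans ac (ltW cs)).
  have ds : `|s - c| < d by rewrite ger0_norm ?subr_ge0 ?(ltW cs) //; lra.
  have := hd s _ ds; rewrite sb (le_trans ac (ltW cs)) => /(_ isT).
  rewrite ger0_norm ?subr_ge0 ?(ltW cs) // => h.
  rewrite (_ : f s - f a = (f s - f c) + (f c - f a)); last by rewrite addrA subrK.
  by case: Sc => _ h2; apply: le_trans (l1MD _ _) _; lra.
have : s <= c by apply: ub_le_sup => //; exists b.
by rewrite leNgt cs.
Qed.

(** The increment form is one-sided at the end points, so it passes to subintervals. *)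
Definition deriv_l1 (a b : R) (f df : R -> 'rV[Cx R]_n) :=
  forall t, a <= t <= b -> forall e : R, 0 < e ->
  exists2 d : R, 0 < d & forall s, a <= s <= b -> `|s - t| < d ->
    l1M (f s - f t - (s - t)%:C *: df t) <= e * `|s - t|.

Lemma deriv_l1_sub (a b c d : R) f df :
  a <= c -> d <= b -> deriv_l1 a b f df -> deriv_l1 c d f df.
Proof.
move=> ac db H t /andP[ct td] e e0.
have [|r r0 hr] := H t _ e e0; first by rewrite (le_trans ac) // (le_trans td).
exists r => // s /andP[cs sd]; apply: hr.
by rewrite (le_trans ac) // (le_trans sd).
Qed.

(** The mean value inequality is applied to [f] minus the linear function with slope [v]. *)
Lemma deriv_l1_bound (a b M : R) (f df : R -> 'rV[Cx R]_n) (v : 'rV[Cx R]_n) : a <= b ->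
  deriv_l1 a b f df -> (forall t, a <= t <= b -> l1M (df t - v) <= M) ->
  l1M (f b - f a - (b - a)%:C *: v) <= M * (b - a).
Proof.
move=> ab H HM.
pose g (t : R) : 'rV[Cx R]_n := f t - t%:C *: v.
have gE s t : g s - g t = f s - f t - (s - t)%:C *: v.
  rewrite /g rmorphB scalerBl; apply/rowP => j; rewrite !mxE; ring.
rewrite -gE; apply: mean_value_l1 => // t ht e e0.
have [r r0 hr] := H t ht e e0; exists r => // s hs hst; rewrite gE.
rewrite (_ : _ - _ = (f s - f t - (s - t)%:C *: df t) + (s - t)%:C *: (df t - v)).
  apply: le_trans (l1MD _ _) _; rewrite l1MZ mulrDl addrC lerD ?hr //.
  by rewrite mulrC ler_wpM2r // HM.
by rewrite scalerBr; apply/rowP => j; rewrite !mxE; ring.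
Qed.

Lemma deriv_l1_bound0 (a b M : R) (f df : R -> 'rV[Cx R]_n) : a <= b ->
  deriv_l1 a b f df -> (forall t, a <= t <= b -> l1M (df t) <= M) ->
  l1M (f b - f a) <= M * (b - a).
Proof.
move=> ab H HM; have := @deriv_l1_bound a b M f df 0 ab H.
by rewrite scaler0 subr0; apply=> t /HM; rewrite subr0.
Qed.

Lemma deriv_l1_lip (a b M : R) (f df : R -> 'rV[Cx R]_n) :
  deriv_l1 a b f df -> (forall t, a <= t <= b -> l1M (df t) <= M) ->
  forall s t, a <= s <= b -> a <= t <= b -> l1M (f s - f t) <= M * `|s - t|.
Proof.
move=> H HM s t; wlog st : s t / t <= s.
  move=> W hs ht; case/orP: (le_total t s) => st; first exact: W.
  by rewrite l1M_distC distrC W.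
move=> /andP[as_ sb] /andP[at_ tb]; rewrite ger0_norm ?subr_ge0 //.
apply: (@deriv_l1_bound0 t s M f df st); first exact: (deriv_l1_sub at_ sb).
by move=> x /andP[tx xs]; apply: HM; rewrite (le_trans at_) //= (le_trans xs).
Qed.

Lemma taylor1_l1 (a b M : R) (f df ddf : R -> 'rV[Cx R]_n) : a <= b ->
  deriv_l1 a b f df -> deriv_l1 a b df ddf ->
  (forall t, a <= t <= b -> l1M (ddf t) <= M) ->
  l1M (f b - f a - (b - a)%:C *: df a) <= M * (b - a) ^+ 2.
Proof.
move=> ab H1 H2 HM.
have M0 : 0 <= M by apply: le_trans (l1M_ge0 _) (HM a _); rewrite lexx ab.
rewrite expr2 mulrA; apply: (deriv_l1_bound ab H1) => t /andP[ta tb].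
apply: le_trans (deriv_l1_lip H2 HM _ _) _; rewrite ?ta ?tb ?lexx //.
by rewrite ger0_norm ?subr_ge0 // ler_wpM2l // lerD2r.
Qed.

(** Subtracting the quadratic [(t - m)^2 / 2] times [ddf m] leaves a function whose derivative is
    within [M * (b - a)^2] of [df m]. The quadratic takes equal values at [a] and [b], so it drops
    out of the increment; this symmetry gives the third order. *)
Lemma midpoint_l1 (a b M : R) (f df ddf dddf : R -> 'rV[Cx R]_n) : a <= b ->
  deriv_l1 a b f df -> deriv_l1 a b df ddf -> deriv_l1 a b ddf dddf ->
  (forall t, a <= t <= b -> l1M (dddf t) <= M) ->
  l1M (f b - f a - (b - a)%:C *: df ((a + b) / 2)) <= M * (b - a) ^+ 3.
Proof.
move=> ab H1 H2 H3 HM.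
have M0 : 0 <= M by apply: le_trans (l1M_ge0 _) (HM a _); rewrite lexx ab.
set m := (a + b) / 2.
have [am mb] : a <= m /\ m <= b by rewrite /m; lra.
have hm : a <= m <= b by rewrite am.
pose g (t : R) : 'rV[Cx R]_n := f t - ((t - m) ^+ 2 / 2)%:C *: ddf m.
pose dg (t : R) : 'rV[Cx R]_n := df t - (t - m)%:C *: ddf m.
have dgE t : a <= t <= b -> l1M (dg t - df m) <= M * (b - a) ^+ 2.
  move=> ht; have /andP[ta tb] := ht.
  have hx x : a <= x <= b -> l1M (ddf x - ddf m) <= M * (b - a).
    move=> hx; apply: le_trans (deriv_l1_lip H3 HM hx hm) _.
    rewrite ler_wpM2l // ler_norml; lra.
  rewrite /dg; case/orP: (le_total m t) => mt.
    rewrite (_ : _ - _ = df t - df m - (t - m)%:C *: ddf m); last first.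
      by apply/rowP => j; rewrite !mxE; ring.
    apply: le_trans (deriv_l1_bound (M := M * (b - a)) mt (deriv_l1_sub am tb H2) _) _.
      move=> x /andP[mx xt]; apply: (hx x).
      by rewrite (le_trans am mx) (le_trans xt tb).
    by rewrite expr2 mulrA ler_wpM2l ?mulr_ge0 ?subr_ge0 // lerB.
  rewrite -l1MN (_ : - _ = df m - df t - (m - t)%:C *: ddf m); last first.
    by apply/rowP => j; rewrite !mxE !rmorphB; ring.
  apply: le_trans (deriv_l1_bound (M := M * (b - a)) mt (deriv_l1_sub ta mb H2) _) _.
    move=> x /andP[tx xm]; apply: (hx x).
    by rewrite (le_trans ta tx) (le_trans xm mb).
  by rewrite expr2 mulrA ler_wpM2l ?mulr_ge0 ?subr_ge0 // lerB.
have Hg : deriv_l1 a b g dg.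
  move=> t ht e e0.
  have [|r r0 hr] := H1 t ht (e / 2); first by rewrite divr_gt0.
  pose k := l1M (ddf m); have k0 : 0 <= k by apply: l1M_ge0.
  (* The second radius makes the quadratic remainder at most [e / 2] times the distance; [k + 1]
     covers the case [k = 0]. *)
  exists (Num.min r (e / (k + 1))).
    by rewrite lt_min r0 divr_gt0 // ltr_wpDl.
  move=> s hs; rewrite lt_min => /andP[sr se].
  rewrite (_ : _ - _ = (f s - f t - (s - t)%:C *: df t)
                       - ((s - t) ^+ 2 / 2)%:C *: ddf m).
    apply: le_trans (l1MB _ _) _; rewrite l1MZ.
    have := hr s hs sr; rewrite -/k.
    move: se; rewrite ltr_pdivlMr; last by rewrite ltr_wpDl.
    rewrite normrM normrX [X in `|_| ^+ 2 * X]ger0_norm // => se h.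
    suff : `|s - t| ^+ 2 / 2 * k <= e / 2 * `|s - t| by lra.
    have := normr_ge0 (s - t); nra.
  have E : ((s - t) ^+ 2 / 2)%:C = ((s - m) ^+ 2 / 2)%:C
      - ((t - m) ^+ 2 / 2)%:C - (s - t)%:C * (t - m)%:C :> Cx R.
    by rewrite -rmorphM -!rmorphB; congr (_%:C); field.
  rewrite /g /dg {}E.
  move: (f s) (f t) (df t) (ddf m) (_ / 2)%:C (_ / 2)%:C (s - t)%:C (t - m)%:C.
  by move=> x y z w A B C D; apply/rowP => j; rewrite !mxE; ring.
have E : f b - f a - (b - a)%:C *: df m = g b - g a - (b - a)%:C *: df m.
  rewrite /g (_ : (b - m) ^+ 2 = (a - m) ^+ 2); last by rewrite /m; field.
  by apply/rowP => j; rewrite !mxE; ring.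
by rewrite E exprS [_ * (_ ^+ 2)]mulrC mulrA; apply: (deriv_l1_bound ab Hg).
Qed.

End MeanValue.

(** Balls are convex, so the segment from [w] to [v] stays where the Jacobian is bounded, and the
    mean value inequality applies along it. *)
Lemma jacobian_bounded_lip (R : realType) n m (N : 'rV[Cx R]_n -> 'rV[Cx R]_m)
    (c : 'rV[Cx R]_n) (r K : R) :
  (forall v : 'rV[Cx R]_n, l1M (v - c) <= r ->
     differentiable N v /\ l1M (jacobian N v) <= K) ->
  forall v w : 'rV[Cx R]_n, l1M (v - c) <= r -> l1M (w - c) <= r ->
  l1M (N v - N w) <= K * l1M (v - w).
Proof.
move=> H v w hv hw.
pose p (t : R) : 'rV[Cx R]_n := w + t%:C *: (v - w).
have pE s t : p s - p t = (s - t)%:C *: (v - w).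
  by rewrite /p rmorphB; apply/rowP => j; rewrite !mxE; ring.
have hp (t : R) : 0 <= t <= 1 -> l1M (p t - c) <= r.
  move=> /andP[t0 t1].
  rewrite (_ : _ - _ = (1 - t)%:C *: (w - c) + t%:C *: (v - c)); last first.
    by rewrite /p rmorphB rmorph1; apply/rowP => j; rewrite !mxE; ring.
  apply: le_trans (l1MD _ _) _; rewrite !l1MZ !ger0_norm ?subr_ge0 //.
  have : (1 - t) * l1M (w - c) <= (1 - t) * r by rewrite ler_wpM2l // subr_ge0.
  have : t * l1M (v - c) <= t * r by rewrite ler_wpM2l.
  lra.
have := @mean_value_l1 R m (N \o p) 0 1 (K * l1M (v - w)) ler01.
have -> : (N \o p) 1 = N v by rewrite /= /p scale1r addrC subrK.
have -> : (N \o p) 0 = N w by rewrite /= /p scale0r addr0.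
rewrite subr0 mulr1; apply => t ht e e0.
pose k := l1M (v - w); have k0 : 0 <= k by apply: l1M_ge0.
have [dN JK] := H _ (hp t ht).
have [|d d0 hd] := differentiable_l1 dN (e := e / (k + 1)).
  by rewrite divr_gt0 // ltr_wpDl.
exists (d / (k + 1)); first by rewrite divr_gt0 // ltr_wpDl.
move=> s hs; rewrite ltr_pdivlMr ?ltr_wpDl // => sd.
have psd : l1M (p s - p t) < d.
  rewrite pE l1MZ; apply: le_lt_trans sd.
  by rewrite ler_wpM2l // lerDl.
have h := hd _ psd.
rewrite -[X in l1M X](subrK ((p s - p t) *m jacobian N (p t))).
apply: le_trans (l1MD _ _) _; rewrite addrC mulrDl lerD //.
  apply: le_trans (l1MM _ _) _; rewrite pE l1MZ -/k.
  rewrite [leRHS]mulrC -[leLHS]mulrA ler_wpM2l // [leRHS]mulrC.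
  by rewrite ler_wpM2l.
apply: le_trans h _; rewrite pE l1MZ -/k.
rewrite [_ * k]mulrC mulrA ler_wpM2r // mulrAC ler_pdivrMr ?ltr_wpDl //.
by rewrite ler_wpM2l ?(ltW e0) // lerDl.
Qed.

(** * Uniform Lipschitz bounds along the solution *)

Section Tube.
Variables (R : realType) (n : nat).

(** Local boundedness around each point of the curve becomes uniform by compactness of the time
    interval. *)
Lemma tube_bounded (g : 'rV[Cx R]_n -> R) (a b : R) (u : R -> 'rV[Cx R]_n) :
  (forall t, a <= t <= b -> forall e : R, 0 < e -> exists2 d : R, 0 < d &
     forall s, a <= s <= b -> `|s - t| < d -> l1M (u s - u t) <= e) ->
  (forall t, a <= t <= b -> exists2 r : R, 0 < r & exists K : R,
     forall v, l1M (v - u t) < r -> g v <= K) ->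
  exists2 r : R, 0 < r & exists K : R,
    forall t (v : 'rV[Cx R]_n), a <= t <= b -> l1M (v - u t) <= r -> g v <= K.
Proof.
move=> uc gb.
have := @segment_compact R a b; rewrite compact_near_coveringP.
(* One parameter serves as bound and as inverse radius: a larger [M] weakens both requirements, so a
   single large [M] can work for all times. *)
pose P (M t : R) := forall v, l1M (v - u t) <= M^-1 -> a <= t <= b -> g v <= M.
move=> /(_ R (pinfty_nbhs R) P _) [].
  move=> t; rewrite /= in_itv /= => ht.
  have [r r0 [K hK]] := gb t ht.
  have [|d d0 hd] := uc t ht (r / 2); first by rewrite divr_gt0.
  (* Taking [M] above [3 / r] puts [M^-1] below [r / 2]; the other half of [r] pays for moving from
     [s] to [t]. *)
  exists (ball t d, [set M | Num.max K (3 / r) < M]).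
    split => /=; first by apply: nbhsx_ballx.
    by exists (Num.max K (3 / r)); split; [exact: num_real|].
  move=> [s M] /= [hs]; rewrite gt_max => /andP[KM rM] v hv hsab.
  apply: le_trans (ltW KM); apply: hK.
  have M0 : 0 < M by apply: lt_trans rM; rewrite divr_gt0.
  have sd : `|s - t| < d by rewrite distrC.
  have h1 := hd s hsab sd.
  have h2 : M^-1 < r / 2.
    rewrite -[ltRHS]invrK ltf_pV2 ?posrE ?invr_gt0 ?divr_gt0 // invf_div.
    by apply: lt_trans rM; rewrite ltr_pM2r ?invr_gt0 //; lra.
  rewrite (_ : v - u t = (v - u s) + (u s - u t)); last by rewrite addrA subrK.
  by apply: le_lt_trans (l1MD _ _) _; lra.
move=> M0 [_ hM].
pose M := Num.max (M0 + 1) 1.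
have M1 : 0 < M by rewrite lt_max ltr01 orbT.
have MM0 : M0 < M by rewrite lt_max ltrDl ltr01.
exists M^-1; rewrite ?invr_gt0 //; exists M => t v ht hv.
by apply: (hM M MM0 t) => //=; rewrite in_itv.
Qed.

(** A differentiable Jacobian is continuous, hence bounded near each [u t]; compactness makes the
    bound uniform, and convexity of the balls turns it into a Lipschitz constant. *)
Lemma tube_lipschitz (N : 'rV[Cx R]_n -> 'rV[Cx R]_n) (a b : R)
    (u : R -> 'rV[Cx R]_n) (delta : R) : 0 < delta ->
  (forall t, a <= t <= b -> forall e : R, 0 < e -> exists2 d : R, 0 < d &
     forall s, a <= s <= b -> `|s - t| < d -> l1M (u s - u t) <= e) ->
  C2_on N (strip a b u delta) ->
  exists r K : R, [/\ 0 < r, 0 <= K,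
    forall t (v : 'rV[Cx R]_n), a <= t <= b -> l1M (v - u t) <= r ->
      l1M (jacobian N v) <= K &
    forall t (v w : 'rV[Cx R]_n), a <= t <= b ->
      l1M (v - u t) <= r -> l1M (w - u t) <= r ->
      l1M (N v - N w) <= K * l1M (v - w)].
Proof.
move=> delta0 uc NC2.
have strip_in t (v : 'rV[Cx R]_n) : a <= t <= b -> l1M (v - u t) < delta ->
    strip a b u delta v.
  by move=> ht hv; exists t => //; apply: le_lt_trans (cnorm_le_l1 _) hv.
have [] := @tube_bounded (fun v => l1M (jacobian N v)) a b u uc.
  move=> t ht.
  have [|_ dJ _] := NC2 (u t).
    by apply: (@strip_in t) => //; rewrite subrr l1M0.
  have := differentiable_continuous dJ.
  pose J (v : 'rV[Cx R]_n) := mxvec (jacobian N v).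
  move=> /(_ [set B | l1M (B - J (u t)) < 1]) h.
  have /h : nbhs (J (u t)) [set B | l1M (B - J (u t)) < 1].
    by apply/nbhs_l1P; exists 1.
  move=> /nbhs_l1P [r r0 hr]; exists r => //.
  exists (n%:R * n%:R * (l1M (J (u t)) + 1)) => v /hr /= hv.
  apply: le_trans (l1M_mxvec _) _; rewrite ler_wpM2l ?mulr_ge0 //.
  by apply: le_trans (l1M_distDr _ (J (u t))) _; rewrite lerD2l ltW.
move=> r r0 [K hK].
have d20 : 0 < delta / 2 by rewrite divr_gt0.
(* Half of [delta] keeps the closed balls inside the open strip. *)
exists (Num.min r (delta / 2)), (Num.max K 0).
have hJ t (v : 'rV[Cx R]_n) : a <= t <= b -> l1M (v - u t) <= Num.min r (delta / 2) ->
    differentiable N v /\ l1M (jacobian N v) <= Num.max K 0.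
  move=> ht; rewrite le_min => /andP[vr vd]; split.
    have [|//] := NC2 v; apply: (@strip_in t) => //.
    by apply: le_lt_trans vd _; lra.
  by apply: le_trans (hK t v ht vr) _; rewrite le_max lexx.
split; first by rewrite lt_min r0.
- by rewrite le_max lexx orbT.
- by move=> t v ht hv; case: (hJ t v ht hv).
- move=> t v w ht; apply: jacobian_bounded_lip => x; exact: hJ.
Qed.

End Tube.

(** * The function phi2 and the resolvent *)

Section MatrixLimits.
Variable R : realType.

Lemma cvg_l1M m n (S : nat -> 'M[Cx R]_(m, n)) (B : 'M[Cx R]_(m, n)) :
  (forall i j, (fun k => complex.Re (S k i j)) @ \oo --> complex.Re (B i j)) ->
  (forall i j, (fun k => complex.Im (S k i j)) @ \oo --> complex.Im (B i j)) ->
  S @ \oo --> B.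
Proof.
move=> HR HI P /nbhs_l1P [r r0 hr].
pose x k i j := `|complex.Re (S k i j) - complex.Re (B i j)|
  + `|complex.Im (S k i j) - complex.Im (B i j)|.
have l1E k : l1M (S k - B) = \sum_i \sum_j x k i j.
  apply: eq_bigr => i _; apply: eq_bigr => j _; rewrite !mxE /l1C /x.
  by case: (S k i j) (B i j) => [? ?] [? ?].
(* The limit 0 is written as a double sum so that convergence can be checked term by term. *)
have : (fun k => l1M (S k - B)) @ \oo --> (\sum_(i < m) \sum_(j < n) 0 : R).
  under eq_fun do rewrite l1E.
  apply: (cvg_big (op := +%R) add_continuous) => i _.
  apply: (cvg_big (op := +%R) add_continuous) => j _.
  rewrite -[X in _ --> X]addr0 -[X in _ --> X + _](@normr0 _ R).
  rewrite -[X in _ --> _ + X](@normr0 _ R).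
  apply: cvgD; apply: cvg_norm; apply/subr_cvg0; [exact: HR | exact: HI].
rewrite big1 => [|i _]; last by rewrite big1.
move=> /cvgrPdist_lt /(_ r r0).
apply: filterS => k; rewrite sub0r normrN ger0_norm ?l1M_ge0 //.
exact: hr.
Qed.

(** Each real and imaginary component converges absolutely by comparison with a geometric series. *)
Lemma is_cvg_series_l1M m n (f : nat -> 'M[Cx R]_(m, n)) (c : R) :
  0 <= c -> (forall k, l1M (f k) <= c * 2^-1 ^+ k) -> cvgn (series f).
Proof.
move=> c0 hf.
have ReD k i j : complex.Re (series f k i j) = series (fun l => complex.Re (f l i j)) k.
  elim: k => [|k IH]; first by rewrite /series /= !big_geq // mxE.
  rewrite !seriesSr -IH mxE.
  by case: (series f k i j) (f k i j) => [? ?] [? ?].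
have ImD k i j : complex.Im (series f k i j) = series (fun l => complex.Im (f l i j)) k.
  elim: k => [|k IH]; first by rewrite /series /= !big_geq // mxE.
  rewrite !seriesSr -IH mxE.
  by case: (series f k i j) (f k i j) => [? ?] [? ?].
have key (x : R^nat) i j : (forall k, `|x k| <= l1C (f k i j)) -> cvgn (series x).
  move=> hx; apply: normed_cvg.
  apply: (@series_le_cvg _ _ (geometric c 2^-1)) => [k|k|k|].
  - exact: normr_ge0.
  - by rewrite /geometric /= mulr_ge0 // exprn_ge0 // invr_ge0.
  - by apply: le_trans (hx k) _; apply: le_trans (l1M_entry _ _ _) (hf k).
  - apply: is_cvg_geometric_series.
    by rewrite ger0_norm ?invr_ge0 // invf_lt1 // ltr1n.
pose B := \matrix_(i < m, j < n) (Complex (limn (series (fun l => complex.Re (f l i j))))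
   (limn (series (fun l => complex.Im (f l i j)))) : Cx R).
apply/cvg_ex; exists B; apply: cvg_l1M => i j.
  rewrite mxE /=; under eq_fun do rewrite ReD.
  by apply: (key _ i j) => k; rewrite /l1C lerDl.
rewrite mxE /=; under eq_fun do rewrite ImD.
by apply: (key _ i j) => k; rewrite /l1C lerDr.
Qed.

(** Exponents start at 1 because the identity matrix has l1 norm [n], not 1. *)
Lemma l1M_exp n (Z : 'M[Cx R]_n) k : l1M (Z ^+ k.+1) <= l1M Z ^+ k.+1.
Proof.
elim: k => [|k IH]; first by rewrite !expr1.
rewrite exprS [leRHS]exprS; apply: le_trans (l1MM _ _) _.
by rewrite ler_wpM2l ?l1M_ge0.
Qed.

Lemma phi2_term_le n (Z : 'M[Cx R]_n) k : l1M Z <= 1 ->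
  l1M (((k.+3)`!%:R : Cx R)^-1 *: Z ^+ k.+1) <= l1M Z * 2^-1 ^+ k.+1.
Proof.
move=> Z1.
have -> : ((k.+3)`!%:R : Cx R)^-1 = ((k.+3)`!%:R^-1)%:C.
  by rewrite fmorphV /= rmorph_nat.
have le2 : 2 ^+ k.+1 <= (k.+3)`!%:R :> R.
  rewrite -natrX ler_nat; elim: k => // k IH.
  by rewrite expnS factS leq_mul.
rewrite l1MZ ger0_norm ?invr_ge0 // mulrC exprVn ler_pM ?l1M_ge0 ?invr_ge0 //.
  apply: le_trans (l1M_exp _ _) _; rewrite exprS ler_piMr ?l1M_ge0 //.
  by rewrite exprn_ile1 ?l1M_ge0.
by rewrite lef_pV2 ?posrE ?exprn_gt0 // ltr0n fact_gt0.
Qed.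

(** The constant term of the series is 1/2, and the remaining terms are dominated by [l1M Z] times a
    geometric series of sum 1. *)
Lemma phi2_half n (Z : 'M[Cx R]_n) : l1M Z <= 1 ->
  l1M (phi2 Z - (2^-1)%:C *: 1%:M) <= l1M Z.
Proof.
move=> Z1; pose f (k : nat) := ((k.+2)`!%:R : Cx R)^-1 *: Z ^+ k.
have f0 : f 0%N = (2^-1)%:C *: 1%:M.
  by rewrite /f expr0 fmorphV /= rmorph_nat.
have hS k : l1M (series f k.+1 - (2^-1)%:C *: 1%:M) <= l1M Z * (1 - 2^-1 ^+ k).
  elim: k => [|k IH].
    by rewrite /series /= big_nat1 f0 subrr l1M0 expr0 subrr mulr0.
  rewrite seriesSr -addrA [f _ + _]addrC addrA.
  apply: le_trans (l1MD _ _) _.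
  have := @phi2_term_le n Z k Z1; rewrite -/(f k.+1) => h.
  rewrite exprS in h *; lra.
have cf : cvgn (series f).
  apply: (@is_cvg_series_l1M _ _ f (l1M (f 0%N) + l1M Z)).
    by rewrite addr_ge0 ?l1M_ge0.
  case=> [|k]; first by rewrite expr0 mulr1 lerDl l1M_ge0.
  apply: le_trans (phi2_term_le _ Z1) _.
  by rewrite ler_wpM2r ?exprn_ge0 ?invr_ge0 // lerDr l1M_ge0.
apply/ler_addgt0Pr => e e0.
have /cf : nbhs (phi2 Z) [set B | l1M (B - phi2 Z) < e].
  by apply/nbhs_l1P; exists e.
(* The index [k.+1] ensures that the partial sum contains the constant term, as [hS] requires. *)
move=> [k _ /(_ k.+1)] /=; rewrite leqnSn => /(_ isT) h.
apply: le_trans (l1M_distD _ (series f k.+1) _) _.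
rewrite addrC lerD //; last by rewrite l1M_distC ltW.
by apply: le_trans (hS k) _; rewrite ler_piMr ?l1M_ge0.
Qed.

(** A kernel vector equals [c] times its image under [L], so its norm is at most half of itself and
    it vanishes; the same contraction estimate bounds [G]. *)
Lemma resolvent_l1 n (L : 'M[Cx R]_n) (c : R) (F : 'rV[Cx R]_n) :
  0 <= c -> c * l1M L <= 2^-1 ->
  let G := F *m invmx (1%:M - c%:C *: L) in
  G = F + c%:C *: (G *m L) /\ l1M G <= 2 * l1M F.
Proof.
move=> c0 cL G.
have bound (v : 'rV[Cx R]_n) : l1M (c%:C *: (v *m L)) <= 2^-1 * l1M v.
  rewrite l1MZ ger0_norm //.
  apply: le_trans (ler_wpM2l c0 (l1MM _ _)) _.
  by rewrite mulrCA mulrC ler_wpM2r ?l1M_ge0.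
have U : 1%:M - c%:C *: L \in unitmx.
  rewrite -row_free_unit -kermx_eq0; apply/rowV0P => v /sub_kermxP.
  rewrite mulmxBr mulmx1 -scalemxAr => /eqP; rewrite subr_eq0 => /eqP hv.
  apply: l1M_eq0; apply/eqP; rewrite eq_le l1M_ge0 andbT.
  by have := bound v; rewrite -hv; lra.
have E : G = F + c%:C *: (G *m L).
  have : G *m (1%:M - c%:C *: L) = F by rewrite /G mulmxKV.
  by rewrite mulmxBr mulmx1 -scalemxAr => /eqP; rewrite subr_eq => /eqP.
split=> //.
have : l1M G <= l1M F + l1M (c%:C *: (G *m L)) by rewrite {1}E l1MD.
by have := bound G; lra.
Qed.

End MatrixLimits.

(** * One step and error propagation *)

Lemma half_le (R : realType) (x : R) : 0 <= x -> x / 2 <= x.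
Proof. by move=> x0; lra. Qed.

Definition vfield (R : realType) n (L : 'M[Cx R]_n)
    (N : 'rV[Cx R]_n -> 'rV[Cx R]_n) (v : 'rV[Cx R]_n) : 'rV[Cx R]_n :=
  v *m L + N v.

(** The three terms compare the resolvent direction with the field, the two inner stages, and [phi2]
    with one half. [GL], [FL] and [vL] stand for images under [L], and [Dphi] for the increment of
    [N] multiplied by [phi2]. *)
Lemma step_sub_midpointE (R : realType) n
    (v G F GL FL vL Nv NU NW Dphi : 'rV[Cx R]_n) (a H H2 : Cx R) :
  F = vL + Nv -> G = F + a *: GL ->
  v + H *: G + H2 *: Dphi - (v + H *: (vL + a *: FL + NW)) =
  (H * a) *: (GL - FL) + H *: (NU - NW) + (H2 *: Dphi - H *: (NU - Nv)).
Proof. by move=> -> ->; apply/rowP => j; rewrite !mxE; ring. Qed.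

(** * One step started near a centre [c], later the exact value at the current time *)

Section OneStep.
Variables (R : realType) (n : nat) (L : 'M[Cx R]_n).
Variables (N : 'rV[Cx R]_n -> 'rV[Cx R]_n) (c : 'rV[Cx R]_n) (r K P : R).
Hypothesis K0 : 0 <= K.
Hypothesis LKP : l1M L + K <= P.
Hypothesis Nlip : forall v w : 'rV[Cx R]_n, l1M (v - c) <= r -> l1M (w - c) <= r ->
  l1M (N v - N w) <= K * l1M (v - w).
Local Notation f := (vfield L N).

Lemma vfield_lip (v w : 'rV[Cx R]_n) : l1M (v - c) <= r -> l1M (w - c) <= r ->
  l1M (f v - f w) <= P * l1M (v - w).
Proof.
move=> hv hw; rewrite /vfield opprD addrACA -mulmxBl.
apply: le_trans (l1MD _ _) _.
apply: le_trans (ler_wpM2r (l1M_ge0 _) LKP); rewrite mulrDl lerD ?Nlip //.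
by rewrite mulrC l1MM.
Qed.

(** The three terms of the splitting contribute 1/2, 1/2 and 2 times [P^2 * B * h^3], which gives
    the factor 3. *)
Lemma himexp2_step_midpoint (Phi : 'rV[Cx R]_n -> 'M[Cx R]_n)
    (v : 'rV[Cx R]_n) (h B : R) :
  0 < h -> h * P <= 1 -> l1M (Phi v) <= P ->
  l1M (v - c) <= r / 2 -> l1M (f v) <= B -> h * B <= r / 2 ->
  l1M (himexp2_step Phi L N h v - (v + h%:C *: f (v + (h / 2)%:C *: f v)))
  <= (3 * P ^+ 2 * B) * h ^+ 3.
Proof.
move=> h0 hP hPhi hv fB hB.
have lP : l1M L <= P by apply: le_trans LKP; rewrite lerDl.
have KP : K <= P by apply: le_trans LKP; rewrite lerDr l1M_ge0.
have P0 : 0 <= P by apply: le_trans KP.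
have B0 : 0 <= B by apply: le_trans (l1M_ge0 _) fB.
have h20 : 0 <= h / 2 by rewrite divr_ge0 // ltW.
have h2h : h / 2 <= h by apply: half_le; rewrite ltW.
have r20 : 0 <= r / 2 by apply: le_trans (l1M_ge0 _) hv.
have hL : h / 2 * l1M L <= 2^-1.
  rewrite mulrAC -[leRHS]mul1r ler_pM2r ?invr_gt0 //.
  by apply: le_trans hP; rewrite ler_pM2l.
rewrite /himexp2_step /= -/(vfield L N v); set F := f v in fB *; set G := F *m _.
have [GE G2] := @resolvent_l1 R n L (h / 2) F h20 hL.
rewrite -/G in GE G2.
have {}G2 : l1M G <= 2 * B by apply: le_trans G2 _; rewrite ler_pM2l.
set U := v + (h / 2)%:C *: G; set phi := phi2 _.
set W := v + _ *: F.
have hUv : l1M (U - v) <= h * B.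
  rewrite /U [v + _]addrC addrK l1MZ ger0_norm //.
  rewrite [leRHS](_ : _ = h / 2 * (2 * B)); last by field.
  by rewrite ler_wpM2l.
have hWv : l1M (W - v) <= h * B.
  rewrite /W [v + _]addrC addrK l1MZ ger0_norm //.
  by rewrite ler_pM ?l1M_ge0.
(* Half of the radius is spent on [v], the other half on the move to the inner stage. *)
have Uc : l1M (U - c) <= r.
  by apply: le_trans (l1M_distD _ v _) _; rewrite [leRHS]splitr lerD // (le_trans hUv).
have Wc : l1M (W - c) <= r.
  by apply: le_trans (l1M_distD _ v _) _; rewrite [leRHS]splitr lerD // (le_trans hWv).
have vc : l1M (v - c) <= r by rewrite [leRHS]splitr ler_wpDl.
have GF : l1M (G - F) <= h * B * P.
  rewrite {1}GE [F + _]addrC addrK l1MZ ger0_norm //.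
  rewrite [leRHS](_ : _ = h / 2 * (2 * B * P)); last by field.
  rewrite ler_wpM2l //; apply: le_trans (l1MM _ _) _.
  by rewrite ler_pM ?l1M_ge0.
have UW : l1M (U - W) <= h / 2 * (h * B * P).
  rewrite /U /W opprD addrACA subrr add0r -scalerBr l1MZ ger0_norm //.
  by rewrite ler_wpM2l.
have NUv : l1M (N U - N v) <= P * (h * B).
  exact: le_trans (Nlip Uc vc) (ler_pM K0 (l1M_ge0 _) KP hUv).
have NUW : l1M (N U - N W) <= P * (h / 2 * (h * B * P)).
  exact: le_trans (Nlip Uc Wc) (ler_pM K0 (l1M_ge0 _) KP UW).
have phiE : l1M (phi - (2^-1)%:C *: 1%:M) <= h * P.
  have hZ : l1M (h%:C *: Phi v) <= h * P.
    by rewrite l1MZ gtr0_norm // ler_pM2l.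
  by apply: le_trans (hZ); apply: phi2_half; apply: le_trans hZ hP.
have -> : f W = v *m L + (h / 2)%:C *: (F *m L) + N W.
  by rewrite /vfield mulmxDl -scalemxAl.
rewrite (@step_sub_midpointE R n v G F (G *m L) (F *m L) (v *m L) (N v) (N U) (N W)) //.
have -> : h%:C *: (N U - N v) = (2 * h)%:C *: ((N U - N v) *m ((2^-1)%:C *: 1%:M)).
  rewrite -scalemxAr mulmx1 scalerA -rmorphM; congr (_%:C *: _).
  by field.
rewrite -scalerBr -mulmxBr -mulmxBl -rmorphM.
apply: le_trans (l1MD _ _) _.
have E1 : l1M ((h * (h / 2))%:C *: ((G - F) *m L)) <= h * (h / 2) * (h * B * P * P).
  rewrite l1MZ ger0_norm ?mulr_ge0 ?(ltW h0) // ler_wpM2l ?mulr_ge0 ?(ltW h0) //.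
  by apply: le_trans (l1MM _ _) _; rewrite ler_pM ?l1M_ge0.
have E2 : l1M (h%:C *: (N U - N W)) <= h * (P * (h / 2 * (h * B * P))).
  by rewrite l1MZ gtr0_norm // ler_pM2l.
have E3 : l1M ((2 * h)%:C *: ((N U - N v) *m (phi - (2^-1)%:C *: 1%:M)))
    <= 2 * h * (P * (h * B) * (h * P)).
  rewrite l1MZ ger0_norm ?mulr_ge0 ?(ltW h0) // ler_wpM2l ?mulr_ge0 ?(ltW h0) //.
  exact: le_trans (l1MM _ _) (ler_pM (l1M_ge0 _) (l1M_ge0 _) NUv phiE).
apply: le_trans (lerD (le_trans (l1MD _ _) (lerD E1 E2)) E3) _.
by rewrite le_eqVlt; apply/orP; left; apply/eqP; field.
Qed.

Lemma midpoint_step_scalar (x h M : R) : 0 < h -> h <= 1 -> 0 <= P -> 0 <= x ->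
  x + h * (P * ((1 + h / 2 * P) * x + M * h ^+ 2)) <=
  (1 + P * (1 + P) * h) * x + P * M * h ^+ 3.
Proof.
move=> h0 h1 P0 x0.
have : (h / 2) * (h * P * P * x) <= 1 * (h * P * P * x).
  rewrite ler_wpM2r ?mulr_ge0 ?(ltW h0) //; lra.
lra.
Qed.

(** Here [xm] and [x1] play the exact values half a step and a full step after [c]. The Lipschitz
    bound propagates the initial error and the midpoint defect, and the quadrature defect is
    added. *)
Lemma midpoint_step_error (v x1 xm d dm : 'rV[Cx R]_n) (h B M : R) :
  0 < h -> h <= 1 ->
  f c = d -> f xm = dm -> l1M (xm - c) <= r ->
  l1M (xm - c - (h / 2)%:C *: d) <= M * h ^+ 2 ->
  l1M (x1 - c - h%:C *: dm) <= M * h ^+ 3 ->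
  l1M (v - c) <= r / 2 -> l1M (f v) <= B -> h * B <= r / 2 ->
  l1M (v + h%:C *: f (v + (h / 2)%:C *: f v) - x1) <=
  (1 + P * (1 + P) * h) * l1M (v - c) + (P * M + M) * h ^+ 3.
Proof.
move=> h0 h1 <- <- xmc Hm H1 hv fB hB.
have P0 : 0 <= P by apply: le_trans LKP; rewrite addr_ge0 ?l1M_ge0.
have B0 : 0 <= B by apply: le_trans (l1M_ge0 _) fB.
have r20 : 0 <= r / 2 by apply: le_trans (l1M_ge0 _) hv.
have cc : l1M (c - c) <= r by rewrite subrr l1M0 [leRHS]splitr addr_ge0.
have vc : l1M (v - c) <= r by rewrite [leRHS]splitr ler_wpDl.
have h20 : 0 <= h / 2 by rewrite divr_ge0 // ltW.
have h2h : h / 2 <= h by apply: half_le; rewrite ltW.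
set W := v + _ *: f v.
have Wc : l1M (W - c) <= r.
  apply: le_trans (l1M_distD _ v _) _; rewrite [leRHS]splitr lerD //.
  rewrite /W [v + _]addrC addrK l1MZ ger0_norm //; apply: le_trans hB.
  by rewrite ler_pM ?l1M_ge0.
have WE : W - xm = (v - c) + (h / 2)%:C *: (f v - f c)
    - (xm - c - (h / 2)%:C *: f c).
  rewrite /W; move: (f v) (f c) (h / 2)%:C => x y a.
  by apply/rowP => j; rewrite !mxE; ring.
have fvc := vfield_lip vc cc.
have Wm : l1M (W - xm) <= (1 + h / 2 * P) * l1M (v - c) + M * h ^+ 2.
  rewrite WE; apply: le_trans (l1MB _ _) (lerD _ Hm).
  apply: le_trans (l1MD _ _) _; rewrite mulrDl mul1r lerD2l l1MZ ger0_norm //.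
  by rewrite -[leRHS]mulrA ler_wpM2l.
rewrite (_ : _ - x1 = (v - c) + h%:C *: (f W - f xm)
    - (x1 - c - h%:C *: f xm)); last first.
  move: (f W) (f xm) (h%:C) => x y a.
  by apply/rowP => j; rewrite !mxE; ring.
apply: le_trans (l1MB _ _) _.
rewrite [(P * M + M) * _]mulrDl addrA lerD //.
apply: le_trans (l1MD _ _) _.
have hfW : l1M (h%:C *: (f W - f xm)) <=
    h * (P * ((1 + h / 2 * P) * l1M (v - c) + M * h ^+ 2)).
  rewrite l1MZ gtr0_norm // ler_pM2l //.
  by apply: le_trans (vfield_lip Wc xmc) _; rewrite ler_wpM2l.
apply: le_trans (lerD (lexx _) hfW) _.
by apply: midpoint_step_scalar => //; exact: l1M_ge0.
Qed.

End OneStep.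

(** * Discrete Gronwall argument and choice of constants *)

Lemma error_recursion (R : realType) (e : nat -> R) (C h r Tm : R) (m : nat) :
  0 <= C -> 0 < h -> h ^+ 2 * expR (C * Tm) <= r -> m%:R * h <= Tm ->
  e 0%N <= 0 ->
  (forall k, (k < m)%N -> e k <= r -> e k.+1 <= (1 + C * h) * e k + C * h ^+ 3) ->
  e m <= expR (C * Tm) * h ^+ 2.
Proof.
move=> C0 h0 hr hm e0 he.
have Ch : 0 <= C * h by rewrite mulr_ge0 ?(ltW h0).
have pow k : (k <= m)%N -> (1 + C * h) ^+ k <= expR (C * Tm).
  move=> km; apply: (@le_trans _ _ (expR (C * h) ^+ k)).
    by rewrite lerXn2r ?nnegrE ?addr_ge0 ?expR_ge0 ?expR_ge1Dx.
  rewrite -expRM_natl ler_expR mulrCA ler_wpM2l //.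
  by apply: le_trans hm; rewrite ler_wpM2r ?(ltW h0) // ler_nat.
(* This bound reproduces itself exactly under the recursion. It also lies below
   [h^2 * expR (C * Tm)], which supplies the condition [e k <= r] for the next step. *)
suff H k : (k <= m)%N -> e k <= h ^+ 2 * ((1 + C * h) ^+ k - 1).
  apply: le_trans (H m (leqnn m)) _; rewrite mulrC ler_wpM2r ?sqr_ge0 //.
  by apply: le_trans (pow m (leqnn m)); rewrite lerBlDr lerDl.
elim: k => [|k IH] km; first by rewrite expr0 subrr mulr0.
have {}IH := IH (ltnW km).
have er : e k <= r.
  apply: le_trans IH _; apply: le_trans hr; rewrite ler_wpM2l ?sqr_ge0 //.
  by apply: le_trans (pow k (ltnW km)); rewrite lerBlDr lerDl.
apply: le_trans (he k km er) _.
apply: (@le_trans _ _ ((1 + C * h) * (h ^+ 2 * ((1 + C * h) ^+ k - 1)) + C * h ^+ 3)).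
  by rewrite lerD2r ler_wpM2l // addr_ge0.
rewrite [(1 + C * h) ^+ k.+1]exprS le_eqVlt; apply/orP; left; apply/eqP; ring.
Qed.

(** One constant majorises both the growth rate, from [P * (1 + P)], and the local error, from the
    other summands, as the recursion uses the same [C] twice. *)
Definition step_const (R : realType) (P B M : R) : R :=
  P * (1 + P) + 3 * P ^+ 2 * B + P * M + M.

Section StepConst.
Variables (R : realType) (P B M : R).
Hypotheses (P0 : 0 <= P) (B0 : 0 <= B) (M0 : 0 <= M).

Lemma step_const_ge0 : 0 <= step_const P B M.
Proof. by rewrite /step_const !(addr_ge0, mulr_ge0, exprn_ge0). Qed.

Lemma step_const_ge_lip : P * (1 + P) <= step_const P B M.
Proof.
have h1 : 0 <= 3 * P ^+ 2 * B by rewrite !(mulr_ge0, exprn_ge0).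
have h2 : 0 <= P * M by rewrite mulr_ge0.
rewrite /step_const; move: M0 h1 h2; lra.
Qed.

Lemma step_const_ge_err : 3 * P ^+ 2 * B + (P * M + M) <= step_const P B M.
Proof.
have h1 : 0 <= P * (1 + P) by rewrite mulr_ge0 // addr_ge0.
rewrite /step_const; lra.
Qed.

Lemma common_upper_bound (E : R) : 0 <= E ->
  exists S : R, [/\ 1 <= S, P <= S, B <= S, M <= S & E <= S].
Proof. by move=> E0; exists (1 + P + B + M + E); split; move: P0 B0 M0 E0; lra. Qed.

End StepConst.

(** * Local error and convergence along the exact solution *)

Section Convergence.
Variables (R : realType) (n : nat) (L : 'M[Cx R]_n).
Variables (N : 'rV[Cx R]_n -> 'rV[Cx R]_n) (t0 T : R).
Variables (u u1 u2 u3 : R -> 'rV[Cx R]_n) (M r K P B : R).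
Hypothesis du : deriv_l1 t0 T u u1.
Hypothesis ode : forall t, t0 <= t <= T -> u1 t = vfield L N (u t).
Hypothesis du1 : deriv_l1 t0 T u1 u2.
Hypothesis du2 : deriv_l1 t0 T u2 u3.
Hypothesis u1M : forall t, t0 <= t <= T -> l1M (u1 t) <= M.
Hypothesis u2M : forall t, t0 <= t <= T -> l1M (u2 t) <= M.
Hypothesis u3M : forall t, t0 <= t <= T -> l1M (u3 t) <= M.
Hypothesis M0 : 0 <= M.
Hypothesis r0 : 0 < r.
Hypothesis K0 : 0 <= K.
Hypothesis LKP : l1M L + K <= P.
Hypothesis MB : M + P * r <= B.
Hypothesis Nlip : forall t (v w : 'rV[Cx R]_n), t0 <= t <= T ->
  l1M (v - u t) <= r -> l1M (w - u t) <= r -> l1M (N v - N w) <= K * l1M (v - w).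

Let P0 : 0 <= P.
Proof. by apply: le_trans LKP; rewrite addr_ge0 ?l1M_ge0. Qed.

Let B0 : 0 <= B.
Proof. by apply: le_trans MB; rewrite addr_ge0 // mulr_ge0 // ltW. Qed.

Local Notation C := (step_const P B M).

Lemma local_error (Phi : 'rV[Cx R]_n -> 'M[Cx R]_n) (h t : R) (v : 'rV[Cx R]_n) :
  (forall t (v : 'rV[Cx R]_n), t0 <= t <= T -> l1M (v - u t) <= r -> l1M (Phi v) <= P) ->
  0 < h -> h <= 1 -> h * P <= 1 -> h * B <= r / 2 -> h * M <= r / 2 ->
  t0 <= t -> t + h <= T -> l1M (v - u t) <= r / 2 ->
  l1M (himexp2_step Phi L N h v - u (t + h)) <=
  (1 + C * h) * l1M (v - u t) + C * h ^+ 3.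
Proof.
move=> hPhi h0 h1 hP hB hM tt0 thT hv.
have h20 : 0 <= h / 2 by rewrite divr_ge0 // ltW.
have h2h : h / 2 <= h by apply: half_le; rewrite ltW.
have tm : t <= t + h / 2 by rewrite lerDl.
have mh : t + h / 2 <= t + h by rewrite lerD2l.
have th : t <= t + h by rewrite lerDl ltW.
have tI : t0 <= t <= T by rewrite tt0 (le_trans th).
have mI : t0 <= t + h / 2 <= T by rewrite (le_trans tt0 tm) (le_trans mh).
have r2r : r / 2 <= r by apply: half_le; rewrite ltW.
have vr : l1M (v - u t) <= r by apply: le_trans r2r.
have cr : l1M (u t - u t) <= r by rewrite subrr l1M0 ltW.
have sub x (a b : R) : t0 <= a -> b <= T -> a <= x <= b -> t0 <= x <= T.
  by move=> h3 h4 /andP[h5 h6]; rewrite (le_trans h3 h5) (le_trans h6 h4).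
(* On the tube the field differs from [u1 t] by at most [P * r], which explains the requirement on
   [B]. *)
have fB : l1M (vfield L N v) <= B.
  apply: le_trans MB; apply: le_trans (l1M_distDr _ (vfield L N (u t))) _.
  rewrite lerD //; first by rewrite -ode // u1M.
  apply: le_trans (vfield_lip LKP (fun v w => @Nlip t v w tI) vr cr) _.
  by rewrite ler_wpM2l.
have xmr : l1M (u (t + h / 2) - u t) <= r.
  apply: le_trans (deriv_l1_lip du u1M mI tI) _.
  rewrite addrAC subrr add0r ger0_norm //; apply: le_trans r2r.
  by apply: le_trans hM; rewrite mulrC ler_wpM2r.
have Hm : l1M (u (t + h / 2) - u t - (h / 2)%:C *: u1 t) <= M * h ^+ 2.
  have mT : t + h / 2 <= T by case/andP: mI.
  have := taylor1_l1 tm (deriv_l1_sub tt0 mT du) (deriv_l1_sub tt0 mT du1)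
    (fun x hx => u2M (sub x _ _ tt0 mT hx)).
  rewrite [t + _ - t]addrAC subrr add0r => /le_trans; apply.
  by rewrite ler_wpM2l // lerXn2r ?nnegrE // ltW.
have H1 : l1M (u (t + h) - u t - h%:C *: u1 (t + h / 2)) <= M * h ^+ 3.
  have := midpoint_l1 th (deriv_l1_sub tt0 thT du) (deriv_l1_sub tt0 thT du1)
    (deriv_l1_sub tt0 thT du2) (fun x hx => u3M (sub x _ _ tt0 thT hx)).
  rewrite [t + _ - t]addrAC subrr add0r (_ : (t + (t + h)) / 2 = t + h / 2) //.
  by field.
have E1 := himexp2_step_midpoint K0 LKP (fun v w => @Nlip t v w tI) h0 hP
  (hPhi t v tI vr) hv fB hB.
have E2 := midpoint_step_error K0 LKP (fun v w => @Nlip t v w tI) h0 h1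
  (esym (ode tI)) (esym (ode mI)) xmr Hm H1 hv fB hB.
pose mid := v + h%:C *: vfield L N (v + (h / 2)%:C *: vfield L N v).
apply: le_trans (l1M_distD _ mid _) _.
apply: le_trans (lerD E1 E2) _.
rewrite addrCA -mulrDl lerD //.
  rewrite ler_wpM2r ?l1M_ge0 // lerD2l ler_wpM2r ?(ltW h0) //.
  exact: step_const_ge_lip.
rewrite ler_wpM2r ?exprn_ge0 ?(ltW h0) //.
exact: step_const_ge_err.
Qed.

(** The constants are chosen before [Phi], so the same pair serves both methods. *)
Lemma himexp2_convergence : exists E h0 : R, 0 < h0 /\
  forall Phi : 'rV[Cx R]_n -> 'M[Cx R]_n,
  (forall t (v : 'rV[Cx R]_n), t0 <= t <= T -> l1M (v - u t) <= r -> l1M (Phi v) <= P) ->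
  forall (h : R) (k : nat), 0 < h <= h0 -> t0 + k%:R * h <= T ->
    cnorm (himexp2_sol Phi L N h (u t0) k - u (t0 + k%:R * h)) <= E * h ^+ 2.
Proof.
pose E := expR (C * (T - t0)).
have E0 : 0 <= E by apply: expR_ge0.
have [S [S1 PS BS MS ES]] := common_upper_bound P0 B0 M0 E0.
have S0 : 0 < S by apply: lt_le_trans S1.
have rho0 : 0 < Num.min 1 (r / 2) by rewrite lt_min ltr01 divr_gt0.
(* Since [S] dominates 1, [P], [B], [M] and [E], the single condition that [h * S] is at most 1 and
   [r / 2] implies every step-size restriction. *)
exists E, (Num.min 1 (r / 2) / S); split; first by rewrite divr_gt0.
move=> Phi hPhi h m /andP[h0]; rewrite ler_pdivlMr // le_min => /andP[hS1 hSr] hm.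
have hS x : x <= S -> h * x <= h * S by move=> xS; rewrite ler_wpM2l ?(ltW h0).
have h1 : h <= 1 by rewrite -[h]mulr1; apply: le_trans (hS _ S1) hS1.
apply: le_trans (cnorm_le_l1 _) _.
pose e k := l1M (himexp2_sol Phi L N h (u t0) k - u (t0 + k%:R * h)).
apply: (@error_recursion R e C h (r / 2) (T - t0) m) => //.
- exact: step_const_ge0.
- apply: le_trans (le_trans (hS _ ES) hSr); rewrite ler_wpM2r //.
  by rewrite expr2 ler_piMr // ltW.
- by rewrite lerBrDl.
- by rewrite /e /= mul0r addr0 subrr l1M0.
move=> k km ek.
have kE : t0 + k.+1%:R * h = (t0 + k%:R * h) + h.
  by rewrite -natr1 mulrDl mul1r addrA.
rewrite /e kE; apply: local_error => //.
- exact: le_trans (hS _ PS) hS1.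
- exact: le_trans (hS _ BS) hSr.
- exact: le_trans (hS _ MS) hSr.
- by rewrite lerDl mulr_ge0 // ltW.
- rewrite -kE; apply: le_trans hm; rewrite lerD2l ler_wpM2r ?(ltW h0) //.
  by rewrite ler_nat.
Qed.

End Convergence.

Theorem theorem4p1 (R : realType) (n : nat) (L : 'M[Cx R]_n)
    (N : 'rV[Cx R]_n -> 'rV[Cx R]_n) (t0 T : R) (u u1 u2 u3 : R -> 'rV[Cx R]_n) :
  t0 <= T ->
  (* u solves u' = L u + N(u) on [t0, T] (initial value u0 := u t0) *)
  has_rderiv_on t0 T u u1 ->
  (forall t, t0 <= t <= T -> u1 t = u t *m L + N (u t)) ->
  (* Assumption 3: u is three times differentiable, bounded derivatives *)
  has_rderiv_on t0 T u1 u2 ->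
  has_rderiv_on t0 T u2 u3 ->
  (exists M : R, forall t, t0 <= t <= T ->
     [/\ cnorm (u1 t) <= M, cnorm (u2 t) <= M & cnorm (u3 t) <= M]) ->
  (* Assumption 3: N is C^2 in a strip along the exact solution *)
  (exists2 delta : R, 0 < delta & C2_on N (strip t0 T u delta)) ->
  (* Re (v, L v) <= 0 *)
  (forall v, complex.Re (cip v (v *m L)) <= 0) ->
  (* L (d/dt N(u(t))) is uniformly bounded *)
  (exists2 dNu : R -> 'rV[Cx R]_n, has_rderiv_on t0 T (fun t => N (u t)) dNu &
     exists M : R, forall t, t0 <= t <= T -> cnorm (dNu t *m L) <= M) ->
  exists C h0 : R, 0 < h0 /\
    forall (h : R) (k : nat), 0 < h <= h0 -> t0 + k%:R * h <= T ->
      cnorm (HImExp2J_sol L N h (u t0) k - u (t0 + k%:R * h)) <= C * h ^+ 2 /\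
      cnorm (HImExp2N_sol L N h (u t0) k - u (t0 + k%:R * h)) <= C * h ^+ 2.
Proof.
move=> t0T /has_rderiv_onE du ode /has_rderiv_onE du1 /has_rderiv_onE du2.
move=> [M1 uM] [delta delta0 NC2] _ _.
(* The factor [n%:R * 2] converts Euclidean bounds into l1 bounds. *)
pose M := n%:R * 2 * M1.
have l1cM (w : 'rV[Cx R]_n) : cnorm w <= M1 -> l1M w <= M.
  by move=> hw; apply: le_trans (l1_le_cnorm _) _; rewrite ler_wpM2l ?mulr_ge0.
have u1M t : t0 <= t <= T -> l1M (u1 t) <= M by move=> /uM[/l1cM].
have u2M t : t0 <= t <= T -> l1M (u2 t) <= M by move=> /uM[_ /l1cM].
have u3M t : t0 <= t <= T -> l1M (u3 t) <= M by move=> /uM[_ _ /l1cM].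
have M0 : 0 <= M by apply: le_trans (l1M_ge0 _) (u1M t0 _); rewrite lexx t0T.
have uc t : t0 <= t <= T -> forall e : R, 0 < e -> exists2 d : R, 0 < d &
    forall s, t0 <= s <= T -> `|s - t| < d -> l1M (u s - u t) <= e.
  move=> ht e e0; have M10 : 0 < M + 1 by rewrite ltr_wpDl.
  exists (e / (M + 1)); first by rewrite divr_gt0.
  move=> s hs; rewrite ltr_pdivlMr // => hst.
  apply: le_trans (deriv_l1_lip du u1M hs ht) _.
  by apply: le_trans (ltW hst); rewrite mulrC ler_wpM2l // lerDl.
have [r [K [r0 K0 JK Nlip]]] := tube_lipschitz delta0 uc NC2.
(* Here [P] is [l1M L + K] and [B] is [M + P * r]; this [P] bounds both choices of [Phi], namely [L]
   plus the Jacobian and the Jacobian alone. *)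
have [C [h0 [h00 H]]] := himexp2_convergence du ode du1 du2 u1M u2M u3M M0 r0 K0
  (lexx (l1M L + K)) (lexx _) Nlip.
exists C, h0; split=> // h k hh hk; split; apply: H => // t v ht hv.
  by apply: le_trans (l1MD _ _) _; rewrite lerD2l; apply: JK ht hv.
by apply: le_trans (JK t v ht hv) _; rewrite lerDr l1M_ge0.
Qed.
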